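(* Let $G$ be a finite simple graph. If $G$ is homomorphic to the generalised Andrásfai graph $F^k_d$ for some integers $k\ge 2$ and $d\ge 1$ (i.e. there is a graph homomorphism $G\to F^k_d$), then $G$ is not $\left(\frac12,\frac{1}{2(2k+1)^2}\right)$-dense.
   Context: All graphs are finite and simple. An $n$-vertex graph $G$ is called $(\alpha,\beta)$-dense if every subset of $\lfloor \alpha n\rfloor$ vertices of $G$ spans (induces) more than $\beta n^2$ edges. For integers $k\ge 2$ and $d\ge 1$ the generalised Andrásfai graph $F^k_d$ is the $d$-regular graph with vertex set $V(F^k_d)=\{v_1,\dots,v_{(2k-1)(d-1)+2}\}$ in which $\{v_i,v_j\}$ is an edge if and only if $(k-1)(d-1)+1\le |i-j|\le k(d-1)+1$. *)

(* Defs.v *)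
From mathcomp Require Import all_boot all_order all_algebra.
Set Implicit Arguments.
Unset Strict Implicit.
Unset Printing Implicit Defensive.
Import Order.TTheory GRing.Theory Num.Theory.

Record sgraph := SGraph {
  vertex :> finType;
  adj : rel vertex;
  adj_sym : symmetric adj;
  adj_irrefl : irreflexive adj }.

Definition edges (G : sgraph) : {set {set G}} :=
  [set [set p.1; p.2] | p : G * G & adj p.1 p.2].

Definition edges_in (G : sgraph) (S : {set G}) : nat :=
  #|[set E in edges G | E \subset S]|.

Definition dense (R : archiRealFieldType) (alpha beta : R) (G : sgraph) : Prop :=
  forall S : {set G},
    (#|S|%:Z = Num.floor (alpha * #|G|%:R))%R ->
    (beta * #|G|%:R ^+ 2 < (edges_in S)%:R)%R.

Definition homomorphic (G H : sgraph) : Prop :=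
  exists f : G -> H, forall x y : G, adj x y -> adj (f x) (f y).

(* The vertex v_i is represented by i - 1, which leaves |i - j| unchanged. *)
Definition andrasfai_vertex (k d : nat) := 'I_((2 * k - 1) * (d - 1) + 2).

(* `|i - j| is the absolute difference of ssrint, not truncated subtraction. *)
Definition andrasfai_adj (k d : nat) : rel (andrasfai_vertex k d) :=
  fun i j => (k - 1) * (d - 1) + 1 <= `|i - j| <= k * (d - 1) + 1.

Lemma andrasfai_adj_sym k d : symmetric (@andrasfai_adj k d).
Proof. by move=> i j; rewrite /andrasfai_adj distnC. Qed.

Lemma andrasfai_adj_irrefl k d : irreflexive (@andrasfai_adj k d).
Proof. by move=> i; rewrite /andrasfai_adj distnn addn1. Qed.

Definition andrasfai (k d : nat) : sgraph :=
  SGraph (@andrasfai_adj_sym k d) (@andrasfai_adj_irrefl k d).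

(* Main.v *)
(* A homomorphism to F^k_d assigns to every vertex a class modulo
   N = (2k-1)(d-1)+2, and adjacent vertices have classes at cyclic distance at
   least a = (k-1)(d-1)+1, where N = 2a + D and D = d-1.  Let v(i) count the
   vertices of class i, n = |G|, u = n/(2k+1), so that beta n^2 = u^2/2, and let
   h(i) = n/2 - (v(i) + ... + v(i+a-1)).

   Starting at the class i, put the first n/2 vertices in cyclic order into S.
   If G is dense, then more than u^2/2 edges in S force, for every i, an arc of
   L vertices in at most D consecutive classes from i on with h(i) L > u^2/2,
   hence 2h(i) + L > 2u; the same holds in the reversed cyclic order.
   Comparing these arcs with windows of D or D+1 classes gives linear
   inequalities between the values of h and the largest weight delta of a
   window of D+1 classes, i.e. the largest degree in the blow-up.  Starting at
   such a window, h(j), h(j+a), ..., h(j+(2k-4)a) sum to exactly n/2 - delta,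
   because (2k-3)a = (k-2)N + D+1, and the inequalities then yield delta < 2u.
   On the other hand, averaging the arc inequalities around the circle gives
   delta > 2u. *)
Require Import Defs.
From mathcomp Require Import all_boot all_order all_algebra.
From mathcomp Require Import zify ring lra.
Set Implicit Arguments.
Unset Strict Implicit.
Unset Printing Implicit Defensive.
Import Order.TTheory GRing.Theory Num.Theory.
Local Open Scope ring_scope.

(** * Sums over windows of consecutive integers, and periodic weights *)

Section Windows.
Variable R : realFieldType.
Implicit Types (v : int -> R) (i j : int) (l m : nat).

Definition window v i l : R := \sum_(t < l) v (i + t%:Z).

Lemma window0 v i : window v i 0 = 0.
Proof. by rewrite /window big_ord0. Qed.

Lemma windowSr v i l : window v i l.+1 = window v i l + v (i + l%:Z).
Proof. by rewrite /window big_ord_recr. Qed.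

Lemma window1 v i : window v i 1 = v i.
Proof. by rewrite windowSr window0 add0r addr0. Qed.

Lemma window_cat v i l m :
  window v i (l + m) = window v i l + window v (i + l%:Z) m.
Proof.
elim: m => [|m IHm]; first by rewrite addn0 window0 addr0.
by rewrite addnS !windowSr IHm -addrA -(addrA i) -PoszD.
Qed.

Lemma window_split v i l m q j :
  m = (l + q)%N -> j = i + l%:Z -> window v i m = window v i l + window v j q.
Proof. by move=> -> ->; exact: window_cat. Qed.

Lemma window_ge0 v i l : (forall z, 0 <= v z) -> 0 <= window v i l.
Proof. by move=> v0; apply: sumr_ge0. Qed.

Lemma window_le v i l m :
  (forall z, 0 <= v z) -> (l <= m)%N -> window v i l <= window v i m.
Proof.
by move=> v0 lm; rewrite -(subnKC lm) window_cat lerDl window_ge0.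
Qed.

Lemma windowD v w i l :
  window (fun z => v z + w z) i l = window v i l + window w i l.
Proof. exact: big_split. Qed.

Lemma window_mirror v i l :
  window (fun z => v (- 1 - z)) i l = window v (- i - l%:Z) l.
Proof.
elim: l => [|l IHl]; first by rewrite !window0.
rewrite windowSr IHl (@window_split v _ 1 l.+1 l (- i - l%:Z)) //; last by lia.
by rewrite window1 addrC; congr (v _ + _); lia.
Qed.

Section Periodic.
Variable N : nat.
Variable v : int -> R.
Hypothesis v_per : forall z, v (z + N%:Z) = v z.

Lemma per_window i l : window v (i + N%:Z) l = window v i l.
Proof. by apply: eq_bigr => t _; rewrite addrAC v_per. Qed.

Lemma per_mulz q z : v (z + q * N%:Z) = v z.
Proof.
have per_nat (m : nat) y : v (y + m%:Z * N%:Z) = v y.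
  elim: m y => [|m IHm] y; first by rewrite mul0r addr0.
  by rewrite -addn1 PoszD mulrDl mul1r addrA v_per IHm.
case: q => m; first exact: per_nat.
by rewrite -(per_nat m.+1 (z + _)); congr v; rewrite NegzE; lia.
Qed.

Lemma window_period i j : window v i N = window v j N.
Proof.
have step (z : int) : window v (z + 1) N = window v z N.
  have := window_cat v z 1 N; rewrite addnC window_cat !window1 v_per.
  by rewrite addrC => /addrI ->.
have steps (m : nat) z : window v (z + m%:Z) N = window v z N.
  elim: m z => [|m IHm] z; first by rewrite addr0.
  by rewrite -addn1 PoszD addrA step IHm.
have [ij|ij] := leP i j.
  by rewrite -(steps `|j - i|%N i); congr window; lia.
by rewrite -(steps `|i - j|%N j); congr window; lia.
Qed.

Lemma window_periods i q l :
  window v i (q * N + l) = q%:R * window v 0 N + window v i l.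
Proof.
elim: q i => [|q IHq] i; first by rewrite mul0r add0r.
rewrite mulSn -addnA window_cat per_window IHq (window_period i 0) -natr1.
by ring.
Qed.

(* Compare the partial sums of [v] at a maximal one and one jump later. *)
Lemma window_period_gt0 : (0 < N)%N ->
  (forall i, exists2 p, (p <= N)%N & 0 < window v i p) -> 0 < window v 0 N.
Proof.
move=> N0 jump.
have [r _ rmax] := @arg_maxP _ _ _ (Ordinal N0) xpredT
  (fun t : 'I_N => window v 0 t) isT.
have [p pN vp] := jump r%:Z.
have [lt_rp|le_rp] := ltnP (r + p) N.
  have /= := rmax (Ordinal lt_rp) isT; rewrite /= window_cat add0r; lra.
have lt' : (r + p - N < N)%N by have := ltn_ord r; lia.
have /= := rmax (Ordinal lt') isT.
have := window_cat v 0 r p; rewrite -[in LHS](subnKC le_rp) window_cat.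
by rewrite per_window add0r /=; lra.
Qed.

Lemma window_argmax l : (0 < N)%N ->
  exists j0, forall j, window v j l <= window v j0 l.
Proof.
move=> N0.
have [r _ rmax] := @arg_maxP _ _ _ (Ordinal N0) xpredT
  (fun t : 'I_N => window v t%:Z l) isT.
exists r%:Z => j; have Nneq0 : N%:Z != 0 by lia.
move: (modz_ge0 j Nneq0) (ltz_pmod j (N0 : 0 < N%:Z)).
rewrite {3}(divz_eq j N); case: (j %% N)%Z => // m _ mN.
have := rmax (Ordinal (mN : m < N)%N) isT; rewrite /= => /(le_trans _); apply.
rewrite le_eqVlt; apply/orP/or_introl/eqP/eq_bigr => t _.
by rewrite -[RHS](per_mulz (j %/ N)%Z); congr v; ring.
Qed.
End Periodic.
End Windows.

(** For r = t + 5, [chain], three times [F] at t + 2, twice [F] at t + 3 and twice [E] give every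
    [x l] the coefficient 8 and leave 6 delta < 12 u. Smaller even [r] have combinations of their
    own. *)
Lemma max_degree_lt (R : realFieldType) (x : nat -> R) (r : nat) (u delta : R) :
  ~~ odd r ->
  (forall l, 2 * u < 2 * x l.+2 + x l.+1 + x l) ->
  (forall l, 2 * u < 2 * x l + x l.+1 + x l.+2) ->
  (forall l, 4 * u < 2 * x l.+1 + 2 * x l + delta) ->
  4 * u < 2 * x 0 + 2 * x r + delta ->
  \sum_(l < r.+1) x l = (r + 5)%:R * u / 2 - delta ->
  delta < 2 * u.
Proof.
move=> r_even F M K E.
have chain t : (10 + 4 * t%:R) * u
    < 8 * \sum_(i < t.+2) x i - 4 * x 0 + 5 * x t.+2 + 3 * x t.+3.
  elim: t => [|t IHt].
    by rewrite !big_ord_recr big_ord0 /=; move: (M 0) (M 1); lra.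
  by rewrite big_ord_recr /= -natr1; move: (F t.+2) (M t.+2); lra.
case: r r_even E => [|[|[|[|[|t]]]]] // _ E; rewrite !big_ord_recr /=.
- by rewrite big_ord0; lra.
- by rewrite big_ord0; move: (K 0) (K 1); lra.
- by rewrite big_ord0; move: (M 0) (M 1) (F 1) (F 2); lra.
have -> : (t.+1.+4 + 5)%:R = t%:R + 10 :> R by rewrite -natrD; congr _%:R; lia.
by move: (chain t) (F t.+2) (F t.+3); rewrite !big_ord_recr /=; lra.
Qed.

Lemma window_sub (R : realFieldType) (v : int -> R) i j l m :
  (forall z, 0 <= v z) ->
  i <= j -> j + m%:Z <= i + l%:Z -> window v j m <= window v i l.
Proof.
move=> v0 ij jl.
rewrite (@window_split _ v i `|j - i|%N l (l - `|j - i|) j); try lia.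
have : window v j m <= window v j (l - `|j - i|) by apply: window_le => //; lia.
have := window_ge0 i `|j - i| v0; lra.
Qed.

Lemma window_sum (R : realFieldType) (v : int -> R) i l m :
  \sum_(t < l) window v (i + (t * m)%:Z) m = window v i (l * m).
Proof.
elim: l => [|l IHl]; first by rewrite big_ord0 window0.
by rewrite big_ord_recr /= IHl mulSn addnC window_cat.
Qed.

(** * Arcs in one cyclic orientation *)

Section Arcs.
Variables (R : realFieldType) (a D : nat).
Local Notation N := (2 * a + D)%N.
Implicit Types (v : int -> R) (i j : int) (l m p q : nat).

Definition mass v : R := window v 0 N.

Definition deficit v i : R := mass v / 2 - window v i a.

(* Bounds the edges inside an initial segment of half the mass, starting at the
   class [i]: a vertex of class [i + m] only reaches the classes from
   [i + m + a] on. *)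
Definition half_set_edges v i : R :=
  \sum_(m < N) v (i + m%:Z) * Num.max 0 (mass v / 2 - window v i (a + m)).

(** The reflection z -> -1 - z carries the half-open window [i, i + l) to [-i - l, -i). *)
Definition mirror v z : R := v (- 1 - z).

Section OneSide.
Variables (v : int -> R) (u : R).
Hypotheses (v_ge0 : forall z, 0 <= v z) (v_per : forall z, v (z + N%:Z) = v z).
Hypothesis (u_ge0 : 0 <= u).
Hypothesis (v_dense : forall i, u ^+ 2 / 2 < half_set_edges v i).

Lemma window_mass i l m j :
  (l + m)%N = N -> j = i + l%:Z -> window v i l + window v j m = mass v.
Proof.
by move=> lm ->; rewrite -window_cat lm (window_period v_per i 0).
Qed.

Lemma deficit_per i : deficit v (i + N%:Z) = deficit v i.
Proof. by rewrite /deficit per_window. Qed.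

(** Otherwise [a] classes already hold half the mass and all maxima in [half_set_edges v i]
    vanish. *)
Lemma deficit_gt0 i : 0 < deficit v i.
Proof.
rewrite ltNge; apply/negP => hi; have := v_dense i; apply/negP; rewrite -leNgt.
rewrite /half_set_edges big1 ?divr_ge0 ?exprn_ge0 // => m _.
have := window_le i v_ge0 (leq_addr m a); move: hi; rewrite /deficit => hi hm.
by rewrite (max_idPl _) ?mulr0 //; lra.
Qed.

(* The arc consists of the classes that contribute to [half_set_edges v i]. *)
Lemma arc i : exists p, [/\ (p < D)%N, window v i (a + p) < mass v / 2,
  u ^+ 2 / 2 < \sum_(m < p.+1) v (i + m%:Z) * (mass v / 2 - window v i (a + m))
  & 2 * u < 2 * deficit v i + window v i p.+1].
Proof.
pose P m := window v i (a + m) < mass v / 2.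
have P0 : exists m, P m.
  by exists 0%N; rewrite /P addn0; have := deficit_gt0 i; rewrite /deficit; lra.
(* The complement of a + D classes is a window of [a] classes, lighter than half the mass. *)
have PD m : P m -> (m < D)%N.
  rewrite ltnNge => Pm; apply/negP => Dm; move: Pm; rewrite /P.
  have := window_le i v_ge0 (_ : a + D <= a + m)%N; rewrite leq_add2l => /(_ Dm).
  have := deficit_gt0 (i - a%:Z); rewrite /deficit.
  have : window v (i - a%:Z) a + window v i (a + D) = mass v.
    by apply: window_mass; lia.
  by lra.
case: (ex_maxnP P0 (fun m Pm => ltnW (PD m Pm))) => p Pp pmax.
have sum_p : half_set_edges v i =
    \sum_(m < p.+1) v (i + m%:Z) * (mass v / 2 - window v i (a + m)).
  pose F m := mass v / 2 - window v i (a + m).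
  rewrite /half_set_edges -(big_mkord xpredT (fun m => v (i + m%:Z) * F m)).
  rewrite -(big_mkord xpredT (fun m => v (i + m%:Z) * Num.max 0 (F m))) /F.
  rewrite (@big_cat_nat _ _ _ p.+1) //=; last by have := PD p Pp; lia.
  rewrite [X in _ + X]big_nat_cond [X in _ + X]big1 ?addr0.
    apply: eq_big_nat => m /andP[_ mp]; rewrite (max_idPr _) // subr_ge0.
    by apply: le_trans (ltW Pp); apply: window_le => //; lia.
  move=> m /andP[/andP[pm _] _]; rewrite (max_idPl _) ?mulr0 // subr_le0.
  by rewrite leNgt; apply/negP => /pmax; lia.
exists p; split=> //; first exact: PD.
  by rewrite -sum_p.
have : u ^+ 2 / 2 < deficit v i * window v i p.+1.
  have := v_dense i; rewrite sum_p => /lt_le_trans; apply.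
  rewrite [leRHS]mulrC [leRHS]mulr_suml; apply: ler_sum => m _.
  apply: ler_wpM2l => //.
  by rewrite /deficit lerD2l lerN2 window_le // leq_addr.
have := deficit_gt0 i; have := window_ge0 i p.+1 v_ge0.
move: (deficit v i) (window v i p.+1) => h L L0 h0 hL.
(* AM-GM: (2h + L)^2 >= 8hL > 4u^2. *)
rewrite -(ltr_pXn2r (_ : 0 < 2)%N) // ?nnegrE ?mulr_ge0 ?addr_ge0 //; last 1 first.
  by rewrite mulr_ge0 // ltW.
by have := sqr_ge0 (2 * h - L); rewrite sqrrB sqrrD !exprMn; lra.
Qed.

(* Its sum over an arc with L vertices exceeds (L - u)^2 / 2. *)
Definition jump_weight z : R := v z * (deficit v z + v z / 2 - u).

(** Replacing [window v i (a + m)] by the window of [a] classes at i + m adds [window v i m] to the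
    factor; with the terms v/2 these additions telescope to half a square. *)
Lemma window_jump_weight i p : window jump_weight i p =
  \sum_(m < p) v (i + m%:Z) * (mass v / 2 - window v i (a + m))
  + window v i p ^+ 2 / 2 - u * window v i p.
Proof.
elim: p => [|p IHp]; first by rewrite !window0 big_ord0; lra.
rewrite windowSr IHp big_ord_recr /= windowSr /jump_weight /deficit.
by rewrite (addnC a) (window_cat v i p); field.
Qed.

Lemma jump_weight_gt0 : 0 < window jump_weight 0 N.
Proof.
have N0 : (0 < N)%N by have [p [pD _]] := arc 0; lia.
apply: window_period_gt0 => // [z|i].
  by rewrite /jump_weight deficit_per v_per.
have [p [pD _ arc_u _]] := arc i; exists p.+1; first by lia.
rewrite window_jump_weight; move: arc_u; set S := \sum_(m < _) _.
by have := sqr_ge0 (window v i p.+1 - u); rewrite sqrrB; lra.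
Qed.
End OneSide.


(** * Both orientations: deficits against the largest degree *)

Section TwoSides.
Variables (v : int -> R) (u : R) (s : nat).
Hypotheses (v_ge0 : forall z, 0 <= v z) (v_per : forall z, v (z + N%:Z) = v z).
Hypothesis (u_ge0 : 0 <= u).
Hypothesis (v_dense : forall i, u ^+ 2 / 2 < half_set_edges v i).
Hypothesis (mirror_dense :
  forall i, u ^+ 2 / 2 < half_set_edges (mirror v) i).
Hypothesis (lt_Da : (D < a)%N).

Lemma mirror_per z : mirror v (z + N%:Z) = mirror v z.
Proof. by rewrite /mirror -(v_per (_ - (_ + _))); congr v; ring. Qed.

Lemma window_mirrorE i l j :
  j = - i - l%:Z -> window (mirror v) i l = window v j l.
Proof. by move=> ->; exact: window_mirror. Qed.

Lemma mass_mirror : mass (mirror v) = mass v.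
Proof. by rewrite /mass (window_mirror v) (window_period v_per _ 0). Qed.

(** The reversed arc, which ends just before the class [e], is the arc of [mirror v] at [- e]. *)
Lemma arc_mirror e : exists q, [/\ (q < D)%N,
  window v (e - a%:Z - q%:Z) (a + q) < mass v / 2
  & 2 * u < 2 * deficit v (e - a%:Z) + window v (e - q.+1%:Z) q.+1].
Proof.
have := arc (v := mirror v) (fun z => v_ge0 _) mirror_per u_ge0 mirror_dense (- e).
move=> [q [qD short _ wide]]; exists q; split=> //.
  by rewrite -(@window_mirrorE (- e)) -?mass_mirror //; lia.
move: wide; rewrite /deficit mass_mirror.
rewrite (@window_mirrorE _ _ (e - a%:Z)); last by lia.
by rewrite (@window_mirrorE _ _ (e - q.+1%:Z)); lia.
Qed.

(** The arc fits in [D] classes; the other 2a classes form two windows of length [a], so those [D]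
    classes weigh exactly the sum of two deficits. *)
Lemma deficit_forward i :
  2 * u < 2 * deficit v i + deficit v (i - a%:Z) + deficit v (i - (2 * a)%:Z).
Proof.
have [p [pD _ _]] := arc v_ge0 v_per u_ge0 v_dense i.
have := window_le i v_ge0 pD; rewrite /deficit.
have : window v (i - (2 * a)%:Z) (2 * a) + window v i D = mass v.
  by apply: (window_mass v_per); lia.
rewrite (@window_split _ _ (i - (2 * a)%:Z) a _ a (i - a%:Z)); try lia.
lra.
Qed.

Lemma deficit_backward i :
  2 * u < 2 * deficit v i + deficit v (i + a%:Z) + deficit v (i + (2 * a)%:Z).
Proof.
have [q [qD _]] := arc_mirror (i + a%:Z); rewrite addrK.
set e := i + a%:Z => wide; move: wide; rewrite /deficit.
have : window v (e - q.+1%:Z) q.+1 <= window v (e - D%:Z) D.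
  by apply: window_sub => //; lia.
have : window v (e - D%:Z) D + window v e (2 * a) = mass v.
  by apply: (window_mass v_per); lia.
rewrite (@window_split _ _ e a _ a (i + (2 * a)%:Z)); try lia.
lra.
Qed.

Section MaxDegree.
Variable j0 : int.
Hypothesis j0_max : forall j, window v j D.+1 <= window v j0 D.+1.
Local Notation delta := (window v j0 D.+1).

(** The arc from [i] on and the reversed arc ending just before [i] are contiguous and together span
    at most D + 1 classes. *)
Lemma deficit_adjacent i :
  4 * u < 2 * deficit v i + 2 * deficit v (i - a%:Z) + delta.
Proof.
have [p [pD p_short _ p_wide]] := arc v_ge0 v_per u_ge0 v_dense i.
have [q [qD q_short q_wide]] := arc_mirror i.
(* Otherwise two windows lighter than half the mass would cover the circle. *)
have pqD : (p + q < D)%N.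
  rewrite ltnNge; apply/negP => le_Dpq.
  have : window v (i - a%:Z - q%:Z) N
      <= window v (i - a%:Z - q%:Z) (a + q + (a + p)).
    by apply: window_le => //; lia.
  rewrite (window_cat _ _ (a + q)) (window_period v_per _ 0) -/(mass v).
  have -> : i - a%:Z - q%:Z + (a + q)%:Z = i by lia.
  by lra.
have := window_cat v (i - q.+1%:Z) q.+1 p.+1; rewrite subrK.
have := j0_max (i - q.+1%:Z).
have : window v (i - q.+1%:Z) (q.+1 + p.+1) <= window v (i - q.+1%:Z) D.+1.
  by apply: window_le => //; lia.
lra.
Qed.

(** The two arcs grow inwards from both ends of the heaviest window and stay disjoint inside it. *)
Lemma deficit_ends :
  4 * u < 2 * deficit v j0 + 2 * deficit v (j0 + D.+1%:Z - a%:Z) + delta.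
Proof.
set e := j0 + D.+1%:Z.
have [p [pD p_short _ p_wide]] := arc v_ge0 v_per u_ge0 v_dense j0.
have [q [qD q_short q_wide]] := arc_mirror e.
(* Otherwise the two light windows overlap in the heaviest one, whose weight
   makes up for the at most [D.+1] classes that they leave uncovered. *)
have pqD : (p + q < D)%N.
  rewrite ltnNge; apply/negP => le_Dpq.
  set b := e - a%:Z - q%:Z in q_short *.
  have : window v j0 (a + p)
      = delta + window v e (a + p - D.+1) by apply: window_split; lia.
  have : window v b (a + q) + window v e (a + p - D.+1)
      = window v b (2 * a + p + q - D.+1).
    by symmetry; apply: window_split; lia.
  have : window v b (2 * a - 1) <= window v b (2 * a + p + q - D.+1).
    by apply: window_le => //; lia.
  have : window v b (2 * a - 1) + window v (b + (2 * a - 1)%N%:Z) D.+1 = mass v.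
    by apply: (window_mass v_per) => //; lia.
  by have := j0_max (b + (2 * a - 1)%N%:Z); lra.
have : delta = window v j0 p.+1 + window v (j0 + p.+1%:Z) (D.+1 - p.+1).
  by apply: window_split; lia.
have : window v (e - q.+1%:Z) q.+1
    <= window v (j0 + p.+1%:Z) (D.+1 - p.+1) by apply: window_sub => //; lia.
lra.
Qed.

(** The windows of [a] classes ending and starting at z share only z, so the two jump weights at z
    add up to v(z) times the weight of the D + 1 classes from z + a on, minus 2u. *)
Lemma delta_gt : 2 * u < delta.
Proof.
have := jump_weight_gt0 v_ge0 v_per u_ge0 v_dense.
have := jump_weight_gt0 (v := mirror v) (fun z => v_ge0 _) mirror_per u_ge0
  mirror_dense.
(* The jump weight of [mirror v], reflected back. *)
pose w z := v z * (mass v / 2 - window v (z + 1 - a%:Z) a + v z / 2 - u).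
have w_per z : w (z + N%:Z) = w z.
  rewrite /w v_per; congr (_ * (_ - _ + _ - _)).
  by rewrite -(per_window v_per (z + 1 - a%:Z)); congr window; ring.
have -> : window (jump_weight (mirror v) u) 0 N = window w 0 N.
  rewrite -(window_period w_per (- 0 - N%:Z)) -window_mirror.
  apply: eq_bigr => t _; rewrite /jump_weight /w /deficit mass_mirror.
  by rewrite (@window_mirrorE _ _ (- 1 - (0 + t%:Z) + 1 - a%:Z)) //; lia.
move=> w_gt0 j_gt0.
have m0 : 0 <= mass v by exact: window_ge0.
suff m_gt0 : 0 < mass v * (delta - 2 * u).
  rewrite -subr_gt0 ltNge; apply/negP => /(mulr_ge0_le0 m0).
  by rewrite leNgt m_gt0.
apply: lt_le_trans (addr_gt0 w_gt0 j_gt0) _; rewrite -windowD mulr_suml.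
apply: ler_sum => t _; rewrite /w /jump_weight -mulrDr; apply: ler_wpM2l => //.
set z := 0 + t%:Z; have := j0_max (z + a%:Z).
have : window v (z + 1 - a%:Z) (2 * a - 1) + window v (z + a%:Z) D.+1 = mass v.
  by apply: (window_mass v_per); lia.
rewrite (@window_split _ _ (z + 1 - a%:Z) (a - 1) _ a z); try lia.
have := @window_split _ v (z + 1 - a%:Z) (a - 1) a 1 z; rewrite window1 /deficit.
by move=> -> //; [lra | lia | lia].
Qed.
End MaxDegree.

(** Here [s] is k - 2, so that 2s + 5 = 2k + 1 and 2s + 1 = 2k - 3. *)
Lemma no_dense_weight : mass v = (s.*2 + 5)%:R * u ->
  (s.*2.+1 * a = s * N + D.+1)%N -> False.
Proof.
move=> mass_u ra.
have N0 : (0 < N)%N by have [p [pD _]] := arc v_ge0 v_per u_ge0 v_dense 0; lia.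
have [j0 j0_max] := window_argmax v_per D.+1 N0.
have := delta_gt j0_max; apply/negP; rewrite -leNgt; apply: ltW.
pose x l := deficit v (j0 + (l * a)%:Z).
apply: (@max_degree_lt R x s.*2) => [|l|l|l||]; rewrite ?odd_double // /x.
- have := deficit_forward (j0 + (l.+2 * a)%:Z).
  by congr (_ < _ + deficit v _ + deficit v _); lia.
- have := deficit_backward (j0 + (l * a)%:Z).
  by congr (_ < _ + deficit v _ + deficit v _); lia.
- have := deficit_adjacent j0_max (j0 + (l.+1 * a)%:Z).
  by congr (_ < _ + _ * deficit v _ + _); lia.
- have := deficit_ends j0_max; rewrite mul0n addr0.
  (* By the length equation, 2sa = sN + D + 1 - a: the last deficit is the one at the far end of the
     heaviest window, [s] turns later. *)
  rewrite -(per_mulz (deficit_per v_per) s%:Z (_ - _)).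
  by congr (_ < _ + _ * deficit v _ + _); lia.
rewrite sumrB window_sum ra (window_periods v_per) -/(mass v).
rewrite sumr_const card_ord mass_u -mulr_natl -natr1 -muln2 natrD natrM.
by field.
Qed.
End TwoSides.

End Arcs.

(** * Initial segments of an ordering of the vertices, and their edges *)

Lemma subset_card_between (T : finType) (A B : {set T}) m :
  A \subset B -> (#|A| <= m <= #|B|)%N ->
  exists S : {set T}, [/\ A \subset S, S \subset B & #|S| = m].
Proof.
move=> sAB /andP[Am mB]; move: {2}(m - #|A|)%N (erefl (m - #|A|)%N) => e.
elim: e A sAB Am => [|e IHe] A sAB Am me.
  by exists A; split=> //; lia.
have /properP[_ [x xB xA]] : A \proper B by rewrite properEcard sAB; lia.
have xAB : x |: A \subset B by rewrite subUset sub1set xB.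
have cxA : #|x |: A| = #|A|.+1 by rewrite cardsU1 xA.
have [||S [sS SB Sm]] := IHe _ xAB; rewrite ?cxA; try lia.
by exists S; split=> //; apply: subset_trans sS; exact: subsetUr.
Qed.

(** Whole levels of [key] are taken as long as they fit, then part of a single level. *)
Lemma subset_card_initial (T : finType) (key : T -> nat) m :
  (m <= #|T|)%N ->
  exists2 S : {set T}, #|S| = m &
    forall l, ([set x | key x < l]%N \subset S)
      || (S \subset [set x | key x < l]%N).
Proof.
move=> mT; pose A l := [set x | key x < l]%N.
have sA l l' : (l <= l')%N -> A l \subset A l'.
  by move=> ll'; apply/subsetP => x; rewrite !inE => /leq_trans; apply.
have exA : exists l, (m <= #|A l|)%N.
  exists (\max_x key x).+1; suff -> : A (\max_x key x).+1 = setT by rewrite cardsT.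
  by apply/setP => x; rewrite !inE ltnS leq_bigmax.
case: (ex_minnP exA) => [[|l] ml lmin].
  have A0 : A 0%N = set0 by apply/setP => x; rewrite !inE.
  exists (A 0%N); last by move=> l; apply/orP; right; exact: sA.
  by move: ml; rewrite A0 cards0; lia.
have [||S [AS SA Sm]] := @subset_card_between _ (A l) (A l.+1) m.
- exact: sA.
- by rewrite ml andbT leqNgt; apply/negP => /ltnW /lmin; lia.
exists S => // l'; have [le_l|lt_l] := leqP l' l.
  by rewrite (subset_trans (sA _ _ le_l)).
by rewrite (subset_trans SA (sA _ _ lt_l)) orbT.
Qed.

(** Each edge is charged to its endpoint of smaller key. *)
Lemma edges_in_le (G : sgraph) (key : G -> nat) (a : nat) (S : {set G}) :
  (forall x y, adj x y -> (key x <= key y)%N -> (key x + a <= key y)%N) ->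
  (edges_in S <= \sum_(x in S) #|S :\: [set y | key y < key x + a]|)%N.
Proof.
move=> far; pose P := [set p : G * G |
  (p.1 \in S) && (p.2 \in S :\: [set y | key y < key p.1 + a]%N)].
apply: (@leq_trans #|[set [set p.1; p.2] | p in P]|).
  apply/subset_leq_card/subsetP => E; rewrite inE => /andP[/imsetP[[x y]]].
  rewrite inE /= => xy -> /subsetP sES.
  have [xS yS] : x \in S /\ y \in S by split; apply: sES; rewrite !inE eqxx ?orbT.
  have [le_xy|/ltnW le_yx] := leqP (key x) (key y).
    apply/imsetP; exists (x, y) => //; rewrite !inE /= xS yS -leqNgt.
    by rewrite far.
  apply/imsetP; exists (y, x); last by rewrite setUC.
  by rewrite !inE /= xS yS -leqNgt far // adj_sym.
apply: leq_trans (leq_imset_card _ _) _; rewrite -sum1_card.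
under [X in (_ <= X)%N]eq_bigr => x _ do rewrite -sum1_card.
by rewrite pair_big_dep /=; apply/eq_leq/eq_bigl => -[x y]; rewrite !inE.
Qed.

Lemma sum_key (R : realFieldType) (T : finType) (key : T -> nat) (n : nat)
    (F : nat -> R) :
  (forall x, key x < n)%N ->
  \sum_x F (key x) = \sum_(m < n) #|[set x | key x == m]|%:R * F m.
Proof.
move=> key_lt; rewrite (partition_big (fun x => Ordinal (key_lt x)) xpredT) //=.
apply: eq_bigr => m _; rewrite -sum1_card natr_sum mulr_suml.
apply: eq_big => [x|x /eqP <-]; last by rewrite mul1r.
by rewrite inE.
Qed.

Lemma eq_half_set_edges (R : realFieldType) a D (v w : int -> R) i :
  v =1 w -> half_set_edges a D v i = half_set_edges a D w i.
Proof.
move=> vw; have eqW j l : window v j l = window w j l by apply: eq_bigr.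
by apply: eq_bigr => m _; rewrite /mass !eqW vw.
Qed.

Lemma natr_half (R : pzSemiRingType) (n : nat) :
  n%:R = (odd n)%:R + n./2%:R * 2 :> R.
Proof. by rewrite -natrM -natrD muln2 odd_double_half. Qed.

Lemma floor_half (R : archiRealFieldType) (n : nat) :
  Num.floor (1 / 2 * n%:R : R) = n./2%:Z.
Proof.
apply: floor_def; rewrite intrD -!pmulrn (natr_half _ n).
by apply/andP; split; case: odd; rewrite ?mulr1n ?mulr0n; lra.
Qed.

(** * From a graph with vertex classes to a periodic weight *)

Section ClassWeight.
Variables (R : archiRealFieldType) (G : sgraph) (g : G -> int) (a D : nat).
Local Notation N := (2 * a + D)%N.

Definition class_weight (z : int) : R := #|[set x | (N %| g x - z)%Z]|%:R.

Lemma class_weight_per z : class_weight (z + N%:Z) = class_weight z.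
Proof.
congr (#|pred_of_set _|%:R); apply/setP => x; rewrite !inE opprD addrA.
by rewrite rpredBr // dvdzz.
Qed.

Hypothesis N_gt0 : (0 < N)%N.

Let key (i : int) (x : G) : nat := `|((g x - i) %% N)%Z|%N.

Let keyE i x : (key i x)%:Z = ((g x - i) %% N)%Z.
Proof. by rewrite /key gez0_abs // modz_ge0 //; lia. Qed.

Let key_lt i x : (key i x < N)%N.
Proof. by rewrite -ltz_nat keyE ltz_pmod. Qed.

Lemma class_weight_key i m : (m < N)%N ->
  class_weight (i + m%:Z) = #|[set x | key i x == m]|%:R.
Proof.
move=> mN; congr (#|pred_of_set _|%:R); apply/setP => x; rewrite !inE.
by rewrite -eqz_nat keyE opprD addrA -eqz_mod_dvd (modz_small (m := m)) //; lia.
Qed.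

Lemma window_class_weight i l : (l <= N)%N ->
  window class_weight i l = #|[set x | (key i x < l)%N]|%:R.
Proof.
move=> lN; rewrite -sum1_card natr_sum big_mkcond /=.
transitivity (\sum_x (key i x < l)%:R : R); last first.
  by apply: eq_bigr => x _; rewrite inE; case: ifP.
rewrite (sum_key (fun m => (m < l)%:R) (key_lt i)) /window.
rewrite (big_ord_widen _ (fun m => class_weight (i + m%:Z)) lN) big_mkcond /=.
apply: eq_bigr => m _; rewrite class_weight_key //.
by case: ifP => _; rewrite ?mulr1 ?mulr0.
Qed.

Lemma mass_class_weight : mass a D class_weight = #|G|%:R.
Proof.
rewrite /mass window_class_weight //; congr _%:R.
by rewrite -cardsT; apply: eq_card => x; rewrite !inE key_lt.
Qed.

(* Take for S an initial segment, of half the vertices, of the cyclic order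
   starting at the class i. *)
Lemma half_set_edges_gt (beta : R) :
  (forall x y, adj x y -> a%:Z <= ((g y - g x) %% N)%Z) ->
  dense (1 / 2) beta G ->
  forall i, beta * #|G|%:R ^+ 2 < half_set_edges a D class_weight i.
Proof.
move=> far G_dense i; have half_le : (#|G|./2 <= #|G|)%N by lia.
have [S S_half S_initial] := subset_card_initial (key i) half_le.
have half_leR : #|S|%:R <= #|G|%:R / 2 :> R.
  by rewrite S_half (natr_half _ #|G|); case: odd; rewrite ?mulr1n ?mulr0n; lra.
apply: lt_le_trans (G_dense S _) _; first by rewrite floor_half S_half.
have far_key x y : adj x y -> (key i x <= key i y)%N ->
    (key i x + a <= key i y)%N.
  (* Both keys are residues below N in increasing order, so their difference does not wrap
     around. *)
  move=> /far axy kxy; suff E : ((g y - g x) %% N)%Z = (key i y)%:Z - (key i x)%:Z.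
    by move: axy; rewrite E; lia.
  have -> : g y - g x = (((g y - i) %/ N)%Z - ((g x - i) %/ N)%Z) * N%:Z
      + ((key i y)%:Z - (key i x)%:Z).
    rewrite mulrBl addrACA -opprD !keyE -!divz_eq; ring.
  by rewrite modzMDl modz_small //; have := key_lt i y; lia.
have := edges_in_le S far_key; rewrite -(ler_nat R) => /le_trans; apply.
rewrite natr_sum big_mkcond /=.
pose F m := Num.max 0 (mass a D class_weight / 2 - window class_weight i (a + m)).
have -> : half_set_edges a D class_weight i = \sum_x F (key i x).
  rewrite (sum_key F (key_lt i)); apply: eq_bigr => m _.
  by rewrite class_weight_key.
apply: ler_sum => x _; case: ifP => _; last by rewrite le_max lexx.
rewrite addnC /F mass_class_weight le_max; set A := [set y | _].
(* As [S] is comparable with [A], either nothing of [S] lies beyond [A], or exactly |S| - |A|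
   vertices do. *)
have [sAS|sSA] := orP (S_initial (a + key i x)%N); last first.
  by move: sSA; rewrite -setD_eq0 => /eqP ->; rewrite cards0 lexx.
(* Past a full turn the window no longer counts a set, but then [A] contains every vertex. *)
have [lN|Nl] := leqP (a + key i x) N; last first.
  rewrite (_ : _ :\: _ = set0) ?cards0 ?lexx //; apply/setP => y.
  by rewrite !inE (ltn_trans (key_lt i y) Nl).
rewrite window_class_weight // cardsD (setIidPr sAS) natrB ?subset_leq_card //.
by apply/orP; right; rewrite lerD2r.
Qed.
End ClassWeight.

(** * Application to the generalised Andrásfai graphs *)

Lemma modz_diff_ge (a N p q : nat) :
  (p < N)%N -> (q < N)%N -> (a <= `|p%:Z - q%:Z|%N <= N - a)%N ->
  a%:Z <= ((p%:Z - q%:Z) %% N)%Z.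
Proof.
move=> pN qN pq; have [le_qp|lt_pq] := leqP q p.
  by rewrite modz_small; lia.
by rewrite -modzDr modz_small; lia.
Qed.

Lemma class_weight_mirror (R : archiRealFieldType) (G : sgraph) (g : G -> int)
    a D :
  @class_weight R G (fun x => - 1 - g x) a D =1 mirror (class_weight R g a D).
Proof.
move=> z; congr (#|pred_of_set _|%:R); apply/setP => x; rewrite !inE -rpredN.
by congr (_ %| _)%Z; ring.
Qed.

Theorem theorem1p4 (R : archiRealFieldType) (G : sgraph) (k d : nat)
    (hk : (2 <= k)%N) (hd : (1 <= d)%N)
    (hG : homomorphic G (andrasfai k d)) :
  ~ dense (1 / 2 : R) (1 / (2 * (2 * k%:R + 1) ^+ 2)) G.
Proof.
move=> G_dense; have [f f_hom] := hG.
pose D := (d - 1)%N; pose a := ((k - 1) * D + 1)%N; pose s := (k - 2)%N.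
have N_gt0 : (0 < 2 * a + D)%N by lia.
have NE : ((2 * k - 1) * (d - 1) + 2 = 2 * a + D)%N by rewrite /a /D; nia.
have f_lt x : (f x < 2 * a + D)%N by rewrite -NE ltn_ord.
(* The upper bound k(d-1) + 1 on |i - j| equals N - a, so adjacent classes are at least [a] apart
   both ways around. *)
have gap x y : adj x y -> (a <= `|(f y)%:Z - (f x)%:Z|%N <= 2 * a + D - a)%N.
  move=> xy; have := f_hom y x; rewrite adj_sym => /(_ xy).
  by rewrite /= /andrasfai_adj /a /D; nia.
have far x y : adj x y ->
    a%:Z <= (((f y)%:Z - (f x)%:Z) %% (2 * a + D)%N)%Z.
  by move=> xy; apply: modz_diff_ge; rewrite ?gap.
have mirror_far x y : adj x y ->
    a%:Z <= (((- 1 - (f y)%:Z) - (- 1 - (f x)%:Z)) %% (2 * a + D)%N)%Z.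
  rewrite adj_sym => /far; congr (_ <= (_ %% _)%Z); ring.
pose v := class_weight R (fun x => (f x)%:Z) a D.
pose u : R := #|G|%:R / (2 * k%:R + 1).
have k1 : 0 < 2 * k%:R + 1 :> R by rewrite ltr_wpDl ?mulr_ge0.
have uE : 1 / (2 * (2 * k%:R + 1) ^+ 2) * #|G|%:R ^+ 2 = u ^+ 2 / 2.
  by rewrite /u; field; apply: lt0r_neq0.
apply: (@no_dense_weight R a D v u s) => [z|z||i|i|||].
- exact: ler0n.
- exact: class_weight_per.
- by rewrite divr_ge0 // ltW.
- by rewrite -uE; exact: half_set_edges_gt.
- have f_mirror := class_weight_mirror R (fun x => (f x)%:Z) a D.
  rewrite -(eq_half_set_edges _ _ _ f_mirror) -uE.
  exact: half_set_edges_gt.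
- by rewrite /a /D; nia.
- have -> : (s.*2 + 5)%:R = 2 * k%:R + 1 :> R.
    by rewrite -natrM natr1; congr _%:R; lia.
  by rewrite (mass_class_weight _ _ N_gt0) mulrC divfK // lt0r_neq0.
by rewrite /a /s /D; nia.
Qed.
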